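(* Let $\mathcal{C}$ be a class of groups closed under taking subgroups. Then the following statements are equivalent: 1. $\mathcal{C}$ satisfies the Gruenberg condition (and, hence, is a root class). 2. $\mathcal{C}$ is closed under Cartesian wreath products, i.e. for any $X, Y \in \mathcal{C}$ the Cartesian wreath product $X \wr Y$ belongs to $\mathcal{C}$. 3. $\mathcal{C}$ is closed under extensions and, for any two groups $X, Y \in \mathcal{C}$, contains the Cartesian product $\prod_{y \in Y} X_y$, where $X_y$ is an isomorphic copy of $X$ for every $y \in Y$.
   Context: As usual, a class of groups is assumed to be closed under isomorphism; a $\mathcal{C}$-group is a group belonging to $\mathcal{C}$. Gruenberg condition for $\mathcal{C}$: for any group $X$ and any subnormal sequence $Z \leqslant Y \leqslant X$ with factors in $\mathcal{C}$ (that is, $Z$ is normal in $Y$, $Y$ is normal in $X$, and $Y/Z, X/Y \in \mathcal{C}$), there exists a normal subgroup $T$ of $X$ such that $T \leqslant Z$ and $X/T \in \mathcal{C}$. A class of groups $\mathcal{C}$ is called a root class if (1) every subgroup of a $\mathcal{C}$-group is a $\mathcal{C}$-group; (2) the direct product of any two $\mathcal{C}$-groups belongs to $\mathcal{C}$; (3) $\mathcal{C}$ satisfies the Gruenberg condition. Cartesian wreath product $X \wr Y$: let $B$ be the group of all functions $Y \to X$ with coordinate-wise multiplication (the full, unrestricted Cartesian power of $X$). For $b \in B$ and $u \in Y$ let $b^{u} \in B$ be given by $b^{u}(y) = b(uy)$ for $y \in Y$. Then $X \wr Y$ is the set of formal products $yb$ ($y \in Y$, $b \in B$) with multiplication $(y_1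 b_1)(y_2 b_2) = (y_1 y_2)(b_1^{y_2} b_2)$. Closed under extensions: if a group $G$ has a normal subgroup $N$ with $N \in \mathcal{C}$ and $G/N \in \mathcal{C}$, then $G \in \mathcal{C}$. Cartesian products are unrestricted direct products. *)

(* Defs.v *)
From HB Require Import structures.
From mathcomp Require Import all_boot.
From mathcomp Require Import boolp.

Set Implicit Arguments.
Unset Strict Implicit.
Unset Printing Implicit Defensive.

Local Open Scope group_scope.
Local Open Scope quotient_scope.

(* A groupType has a decidable equality and a choice operator; by the axioms of
   boolp every group can be given such a structure, and every subset of it is a
   boolean predicate, so groupClosed and normalClosed range over all (normal)
   subgroups. *)

Definition isomorphic (G H : groupType) : Prop :=
  exists f : {multiplicative G -> H}, bijective f.

HB.mixin Record isConjClosed (G : groupType) (S : {pred G}) := {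
  gpred_conj : forall x y : G, x \in S -> x ^ y \in S
}.

#[short(type="normalClosed")]
HB.structure Definition NormalClosed (G : groupType) :=
  {S of GroupClosed G S & isConjClosed G S}.

Definition subg (G : groupType) (S : groupClosed G) : Type := {x : G | x \in S}.

Section SubgGroup.
Variables (G : groupType) (S : groupClosed G).

HB.instance Definition _ := SubChoice.on (subg S).

Lemma subg_group_closed : group_closed (fun x : G => x \in S).
Proof. by split; [exact: gpred1 | move=> x y; exact: gpredF]. Qed.

HB.instance Definition _ :=
  SubChoice_isSubGroup.Build G _ (subg S) subg_group_closed.

End SubgGroup.

Section Quotient.
Variables (G : groupType) (N : normalClosed G).

Definition coset_rel : rel G := fun x y => x^-1 * y \in N.

Lemma coset_rel_equiv : equiv_class_of coset_rel.
Proof.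
rewrite /coset_rel; split=> [x | x y | y x z xy yz].
- by rewrite mulVg gpred1.
- by rewrite -gpredV invgM invgK.
- by rewrite -(mulgK y x^-1) -mulgA gpredM.
Qed.

Canonical coset_equiv := EquivRelPack coset_rel_equiv.

Definition quotg : Type := {eq_quot coset_rel}.
HB.instance Definition _ := EqQuotient.on quotg.
HB.instance Definition _ := Choice.on quotg.

(* The product is computed on representatives; quotg_piM below states that it is
   induced by the product of G. *)
Definition quotg_one : quotg := \pi_quotg 1.
Definition quotg_mul (a b : quotg) : quotg := \pi_quotg (repr a * repr b).
Definition quotg_inv (a : quotg) : quotg := \pi_quotg (repr a)^-1.

Lemma quotg_eq (x y : G) :
  (\pi_quotg x = \pi_quotg y) <-> (x^-1 * y \in N).
Proof.
have E : (\pi_quotg x == \pi_quotg y) = coset_rel x y by exact: pi_eq_quot.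
by split=> [/eqP | xy]; [rewrite E | apply/eqP; rewrite E].
Qed.

Lemma quotg_repr (x : G) : x^-1 * repr (\pi_quotg x) \in N.
Proof. by apply/quotg_eq; rewrite reprK. Qed.

Lemma quotg_piM (x y : G) :
  quotg_mul (\pi_quotg x) (\pi_quotg y) = \pi_quotg (x * y).
Proof.
apply/esym/quotg_eq.
have -> : (x * y)^-1 * (repr (\pi_quotg x) * repr (\pi_quotg y)) =
  (x^-1 * repr (\pi_quotg x)) ^ y * (y^-1 * repr (\pi_quotg y)).
  by rewrite conjgE invgM !mulgA mulgK.
by rewrite gpredM ?quotg_repr ?gpred_conj ?quotg_repr.
Qed.

Lemma quotg_piV (x : G) : quotg_inv (\pi_quotg x) = \pi_quotg x^-1.
Proof.
apply/quotg_eq; rewrite invgK.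
have := gpred_conj _ x^-1 (quotg_repr x).
by rewrite conjgE invgK mulgA mulVKg.
Qed.

Lemma quotg_mulA : associative quotg_mul.
Proof.
move=> a b c; rewrite -[a]reprK -[b]reprK -[c]reprK.
set x := repr a; set y := repr b; set z := repr c.
by rewrite (quotg_piM y) (quotg_piM x y) !quotg_piM mulgA.
Qed.
Lemma quotg_mul1 : left_id quotg_one quotg_mul.
Proof. by move=> a; rewrite -[a]reprK quotg_piM mul1g. Qed.
Lemma quotg_mulr1 : right_id quotg_one quotg_mul.
Proof. by move=> a; rewrite -[a]reprK quotg_piM mulg1. Qed.
Lemma quotg_mulV : left_inverse quotg_one quotg_inv quotg_mul.
Proof. by move=> a; rewrite -[a]reprK quotg_piV quotg_piM mulVg. Qed.
Lemma quotg_mulrV : right_inverse quotg_one quotg_inv quotg_mul.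
Proof. by move=> a; rewrite -[a]reprK quotg_piV quotg_piM mulgV. Qed.

HB.instance Definition _ := isGroup.Build quotg
  quotg_mulA quotg_mul1 quotg_mulr1 quotg_mulV quotg_mulrV.

End Quotient.

Section CartesianProduct.
Variables (I : Type) (X_ : I -> groupType).

(* I is arbitrary and all functions are allowed: the unrestricted product. *)
Definition cprod : Type := forall i, X_ i.
HB.instance Definition _ := gen_eqMixin cprod.
HB.instance Definition _ := gen_choiceMixin cprod.

Definition cprod_one : cprod := fun=> 1.
Definition cprod_mul (a b : cprod) : cprod := fun i => a i * b i.
Definition cprod_inv (a : cprod) : cprod := fun i => (a i)^-1.

Lemma cprod_mulA : associative cprod_mul.
Proof.
by move=> a b c; apply: functional_extensionality_dep => i; apply: mulgA.
Qed.
Lemma cprod_mul1 : left_id cprod_one cprod_mul.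
Proof. by move=> a; apply: functional_extensionality_dep => i; apply: mul1g. Qed.
Lemma cprod_mulr1 : right_id cprod_one cprod_mul.
Proof. by move=> a; apply: functional_extensionality_dep => i; apply: mulg1. Qed.
Lemma cprod_mulV : left_inverse cprod_one cprod_inv cprod_mul.
Proof. by move=> a; apply: functional_extensionality_dep => i; apply: mulVg. Qed.
Lemma cprod_mulrV : right_inverse cprod_one cprod_inv cprod_mul.
Proof. by move=> a; apply: functional_extensionality_dep => i; apply: mulgV. Qed.

HB.instance Definition _ := isGroup.Build cprod
  cprod_mulA cprod_mul1 cprod_mulr1 cprod_mulV cprod_mulrV.

End CartesianProduct.

Section Wreath.
Variables X Y : groupType.

Let B : groupType := cprod (fun _ : Y => X).

(* b^u *)
Definition wr_act (b : B) (u : Y) : B := fun y => b (u * y).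

(* The pair (y, b) stands for the formal product yb. Only the choice structure
   of the pair type is inherited: the group law is wreath_mul, not the
   componentwise product. *)
Definition wreath : Type := (Y * B)%type.
HB.instance Definition _ := Choice.on wreath.

Definition wreath_one : wreath := (1, 1).
Definition wreath_mul (g h : wreath) : wreath :=
  (g.1 * h.1, wr_act g.2 h.1 * h.2).
Definition wreath_inv (g : wreath) : wreath := (g.1^-1, wr_act g.2^-1 g.1^-1).

Lemma wr_act1 b : wr_act b 1 = b.
Proof. by apply: functional_extensionality_dep => y; rewrite /wr_act mul1g. Qed.
Lemma wr_actM b u v : wr_act (wr_act b u) v = wr_act b (u * v).
Proof. by apply: functional_extensionality_dep => y; rewrite /wr_act mulgA. Qed.
Lemma wr_act_mul b c u : wr_act (b * c) u = wr_act b u * wr_act c u.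
Proof. by []. Qed.
Lemma wr_act_one u : wr_act 1 u = 1.
Proof. by []. Qed.

Lemma wreath_mulA : associative wreath_mul.
Proof.
by move=> g h k; rewrite /wreath_mul /= wr_act_mul wr_actM !mulgA.
Qed.
Lemma wreath_mul1 : left_id wreath_one wreath_mul.
Proof. by case=> y b; rewrite /wreath_mul /= wr_act_one !mul1g. Qed.
Lemma wreath_mulr1 : right_id wreath_one wreath_mul.
Proof. by case=> y b; rewrite /wreath_mul /= wr_act1 !mulg1. Qed.
Lemma wreath_mulV : left_inverse wreath_one wreath_inv wreath_mul.
Proof.
by case=> y b; rewrite /wreath_mul /= wr_actM !mulVg wr_act1 mulVg.
Qed.
Lemma wreath_mulrV : right_inverse wreath_one wreath_inv wreath_mul.
Proof.
by case=> y b; rewrite /wreath_mul /= mulgV -wr_act_mul mulgV wr_act_one.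
Qed.

HB.instance Definition _ := isGroup.Build wreath
  wreath_mulA wreath_mul1 wreath_mulr1 wreath_mulV wreath_mulrV.

End Wreath.

Section Classes.
Variable C : groupType -> Prop.

(* As C sees the whole groupType record, this also makes C insensitive to the
   choice operators. *)
Definition isomorphism_closed : Prop :=
  forall G H : groupType, isomorphic G H -> C G -> C H.

Definition subgroup_closed : Prop :=
  forall (G : groupType) (H : groupClosed G), C G -> C (subg H).

Definition product_closed : Prop :=
  forall G H : groupType, C G -> C H -> C (G * H)%type.

(* Z is given as a subgroup of the group subg Y; the condition on t reads
   T <= Z inside X. *)
Definition gruenberg : Prop :=
  forall (X : groupType) (Y : normalClosed X) (Z : normalClosed (subg Y)),
    C (quotg Z) -> C (quotg Y) ->
    exists2 T : normalClosed X,
      (forall t, t \in T -> exists2 z : subg Y, z \in Z & val z = t)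
      & C (quotg T).

Definition root_class : Prop :=
  [/\ subgroup_closed, product_closed & gruenberg].

Definition wreath_closed : Prop :=
  forall X Y : groupType, C X -> C Y -> C (wreath X Y).

Definition extension_closed : Prop :=
  forall (G : groupType) (N : normalClosed G),
    C (subg N) -> C (quotg N) -> C G.

Definition cartesian_power_closed : Prop :=
  forall X Y : groupType, C X -> C Y ->
  forall X_ : Y -> groupType, (forall y, isomorphic X (X_ y)) -> C (cprod X_).

End Classes.

(* Main.v *)
(** The equivalence rests on the Kaluzhnin-Krasner embedding, applied to a
    subnormal series Z <= Y <= X instead of a single normal subgroup.  Fix a
    transversal r of Y in X.  Sending x to its coset together with the function
    c |-> r(xc)^-1 x r(c) Z is a homomorphism from X to (Y/Z) wr (X/Y), and its
    kernel T lies in Z.  Closure under wreath products therefore gives the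
    Gruenberg condition, as X/T embeds in the wreath product.

    Conversely, in W = X wr Y let B be the base group and Z <= B the functions
    trivial at 1.  Conjugation by Y moves every coordinate to 1, so a normal
    subgroup of W contained in Z is trivial, and the Gruenberg condition for
    Z <= B <= W says that W itself belongs to the class.  Applied to
    1 <= N <= G it says that the class is closed under extensions, and W is an
    extension of the Cartesian power B by Y. *)
Require Import Defs.
From HB Require Import structures.
From mathcomp Require Import all_boot.
From mathcomp Require Import boolp.

Set Implicit Arguments.
Unset Strict Implicit.
Unset Printing Implicit Defensive.

Local Open Scope group_scope.
Local Open Scope quotient_scope.

Local Notation hom := UMagmaMorphism.type.

(* The argument isGroupMorphism expects; between groups, unlike magmas,
   preservation of the unit comes for free. *)
Lemma morphF (G H : groupType) (f : G -> H) :
  {morph f : x y / x * y} -> {morph f : x y / x / y}.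
Proof.
by move=> fM x y; rewrite -[x in RHS](mulgVK y) [in RHS]fM mulgK.
Qed.

Definition in_subg (G : groupType) (S : groupClosed G) x (xS : x \in S) :
  subg S := exist (fun y => y \in S) x xS.

(** * Kernels and images of homomorphisms *)

Section KernelImage.
Variables (G H : groupType) (f : hom G H).

Definition kerg : {pred G} := [pred x | f x == 1].
Definition imgg : {pred H} := [pred y | `[< exists x, f x = y >]].

Lemma kergE x : (x \in kerg) = (f x == 1). Proof. by []. Qed.

Lemma imggP y : reflect (exists x, f x = y) (y \in imgg).
Proof. exact: asboolP. Qed.

Lemma kerg_mul : {in kerg &, forall x y, x * y \in kerg}.
Proof.
by move=> x y; rewrite !kergE gmulfM => /eqP -> /eqP ->; rewrite mulg1.
Qed.
Lemma kerg_one : 1 \in kerg. Proof. by rewrite kergE gmulf1. Qed.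
Lemma kerg_inv : {in kerg, forall x, x^-1 \in kerg}.
Proof. by move=> x; rewrite !kergE gmulfV => /eqP ->; rewrite invg1. Qed.
Lemma kerg_conj x y : x \in kerg -> x ^ y \in kerg.
Proof. by rewrite !kergE gmulfJ => /eqP ->; rewrite conj1g. Qed.

HB.instance Definition _ := isMulClosed.Build G kerg kerg_mul.
HB.instance Definition _ := isMul1Closed.Build G kerg kerg_one.
HB.instance Definition _ := isInvClosed.Build G kerg kerg_inv.
HB.instance Definition _ := isConjClosed.Build G kerg kerg_conj.

Lemma imgg_mul : {in imgg &, forall x y, x * y \in imgg}.
Proof.
move=> _ _ /imggP[x <-] /imggP[y <-].
by apply/imggP; exists (x * y); rewrite gmulfM.
Qed.
Lemma imgg_one : 1 \in imgg.
Proof. by apply/imggP; exists 1; rewrite gmulf1. Qed.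
Lemma imgg_inv : {in imgg, forall x, x^-1 \in imgg}.
Proof. by move=> _ /imggP[x <-]; apply/imggP; exists x^-1; rewrite gmulfV. Qed.

HB.instance Definition _ := isMulClosed.Build H imgg imgg_mul.
HB.instance Definition _ := isMul1Closed.Build H imgg imgg_one.
HB.instance Definition _ := isInvClosed.Build H imgg imgg_inv.

End KernelImage.

(** * The canonical projection and factorization through it *)

Section QuotientMorphism.
Variables (G : groupType) (N : normalClosed G).

Definition quotg_pi (x : G) : quotg N := \pi_(quotg N) x.

Lemma quotg_pi_morph : {morph quotg_pi : x y / x * y}.
Proof. by move=> x y; rewrite /quotg_pi -quotg_piM. Qed.
HB.instance Definition _ :=
  isGroupMorphism.Build G (quotg N) quotg_pi (morphF quotg_pi_morph).

Lemma quotg_pi_inv x : quotg_pi x^-1 = (quotg_pi x)^-1.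
Proof. exact: gmulfV. Qed.

Lemma quotg_pi_repr (a : quotg N) : quotg_pi (repr a) = a.
Proof. exact: reprK. Qed.

Lemma quotg_pi_eq1 x : quotg_pi x = 1 <-> x \in N.
Proof.
have [] := quotg_eq N 1 x; rewrite invg1 mul1g => eqN Neq.
by split=> [/esym /eqN | /Neq /esym].
Qed.

(** Since [f] kills [N], its value at a representative depends only on the coset; since it kills
    nothing else, the induced map is injective. *)
Lemma quotg_embedding (H : groupType) (f : hom G H) :
  (forall x, f x = 1 <-> x \in N) ->
  exists g : hom (quotg N) H, injective g.
Proof.
move=> fN; pose g (a : quotg N) := f (repr a).
have gpi x : g (quotg_pi x) = f x.
  have /fN := quotg_repr N x; rewrite gmulfM gmulfV => E.
  by apply: (mulgI (f x)^-1); rewrite mulVg.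
have gM : {morph g : a b / a * b}.
  move=> a b; rewrite -[a]quotg_pi_repr -[b]quotg_pi_repr -quotg_pi_morph.
  by rewrite !gpi gmulfM.
pose g' : hom (quotg N) H :=
  HB.pack g (isGroupMorphism.Build _ _ g (morphF gM)).
exists g'; apply: gmulf_inj => a.
by rewrite -[a]quotg_pi_repr => E; apply/quotg_pi_eq1/fN; rewrite -gpi.
Qed.

End QuotientMorphism.

Lemma isomorphic_sym (G H : groupType) : isomorphic G H -> isomorphic H G.
Proof.
case=> f [g fK gK].
pose g' : {multiplicative H -> G} :=
  HB.pack g (isMultiplicative.Build H G g (can2_gmulfM fK gK)).
by exists g'; exists f.
Qed.

(** * Base group and top projection of a wreath product *)

Section WreathMorphism.
Variables X Y : groupType.

Lemma wreathM (v w : wreath X Y) :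
  v * w = (v.1 * w.1, wr_act v.2 w.1 * w.2) :> wreath X Y.
Proof. by []. Qed.

Definition wr_base (b : cprod (fun _ : Y => X)) : wreath X Y := (1, b).

Lemma wr_base_morph : {morph wr_base : b c / b * c}.
Proof.
by move=> b c; rewrite wreathM /= wr_act1 mulg1.
Qed.
HB.instance Definition _ :=
  isGroupMorphism.Build _ _ wr_base (morphF wr_base_morph).

Lemma wr_base_inj : injective wr_base. Proof. by move=> b c []. Qed.

Definition wr_top (w : wreath X Y) : Y := w.1.

Lemma wr_top_morph : {morph wr_top : v w / v * w}.
Proof. by []. Qed.
HB.instance Definition _ :=
  isGroupMorphism.Build _ _ wr_top (morphF wr_top_morph).

Lemma kerg_wr_topE (w : subg (kerg wr_top)) : (val w).1 = 1.
Proof. exact/eqP/(valP w). Qed.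

(** Restricted to the base group, where the shift [wr_act] is trivial, so that evaluation at 1 is
    multiplicative. *)
Definition wr_eval (w : subg (kerg wr_top)) : X := (val w).2 1.

Lemma wr_eval_morph : {morph wr_eval : v w / v * w}.
Proof.
move=> v w; rewrite /wr_eval valM wreathM (kerg_wr_topE w) wr_act1.
by [].
Qed.
HB.instance Definition _ :=
  isGroupMorphism.Build _ _ wr_eval (morphF wr_eval_morph).

End WreathMorphism.

(** * The Kaluzhnin-Krasner homomorphism of a subnormal series *)

Section KaluzhninKrasner.
Variables (X : groupType) (Y : normalClosed X) (Z : normalClosed (subg Y)).
Implicit Types (x : X) (c : quotg Y).

Lemma kk_subproof x c : (repr (quotg_pi Y x * c))^-1 * x * repr c \in Y.
Proof.
apply/(quotg_pi_eq1 Y); rewrite 2!quotg_pi_morph quotg_pi_inv !quotg_pi_repr.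
by rewrite -mulgA mulVg.
Qed.

Definition kk_coord x c : subg Y := in_subg (kk_subproof x c).

Definition kk x : wreath (quotg Z) (quotg Y) :=
  (quotg_pi Y x, fun c => quotg_pi Z (kk_coord x c)).

(** The shift by the coset of [y] evaluates the coordinate of [x] at [yc], so the inner
    representatives of [yc] cancel. *)
Lemma kk_morph : {morph kk : x y / x * y}.
Proof.
move=> x y; rewrite wreathM /= /kk quotg_pi_morph.
congr (_, _); apply: functional_extensionality_dep => c.
rewrite /wr_act [RHS]/mul /= /cprod_mul -quotg_pi_morph; congr (quotg_pi Z _).
by apply: val_inj; rewrite valM /= quotg_pi_morph !mulgA mulgK.
Qed.
HB.instance Definition _ := isGroupMorphism.Build _ _ kk (morphF kk_morph).

Lemma kk_ker x : kk x = 1 -> exists2 z : subg Y, z \in Z & val z = x.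
Proof.
case=> /[dup] x1 /quotg_pi_eq1 xY /(congr1 (@^~ 1)) /= /quotg_pi_eq1 zZ.
have rY : repr (1 : quotg Y) \in Y.
  by apply/quotg_pi_eq1; rewrite quotg_pi_repr.
exists (in_subg xY) => //.
(* The representative of the trivial coset may differ from 1, but it lies in [Y], which normalizes
   [Z]. *)
have <- : kk_coord x 1 ^ (in_subg rY)^-1 = in_subg xY.
  apply: val_inj; rewrite gmulfJ gmulfV /= x1 mul1g.
  by rewrite conjgE invgK !mulgA mulgV mul1g mulgK.
exact: gpred_conj.
Qed.

End KaluzhninKrasner.

(** * Closure properties of the class *)

Section ClassClosure.
Variable C : groupType -> Prop.
Hypotheses (isoC : isomorphism_closed C) (subC : subgroup_closed C).

Lemma class_embedding (G H : groupType) (f : hom G H) :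
  injective f -> C H -> C G.
Proof.
move=> fI CH; apply: isoC (subC (imgg f) CH); apply: isomorphic_sym.
have fim x : f x \in imgg f by apply/imggP; exists x.
pose g x : subg (imgg f) := in_subg (fim x).
have gM : {morph g : x y / x * y}.
  by move=> x y; apply: val_inj; rewrite valM /= gmulfM.
pose g' : {multiplicative G -> subg (imgg f)} :=
  HB.pack g (isMultiplicative.Build _ _ g gM).
have gex (a : subg (imgg f)) : exists x, g x = a.
  have /imggP[x fx] := valP a.
  by exists x; apply: val_inj.
exists g', (fun a => projT1 (cid (gex a))) => [x | a].
  by apply: fI; case: cid => y /= /(congr1 val).
by case: cid.
Qed.

Lemma class_quotient (G H : groupType) (N : normalClosed G) (f : hom G H) :
  (forall x, f x = 1 <-> x \in N) -> C H -> C (quotg N).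
Proof. by move=> /quotg_embedding[g gI]; apply: class_embedding gI. Qed.

Lemma class_quotient_ker (G H : groupType) (f : hom G H) :
  C H -> C (quotg (kerg f)).
Proof. by apply: (class_quotient (f := f)) => x; split=> /eqP. Qed.

Lemma class_quotient1 (G : groupType) (N : normalClosed G) :
  (forall x, x \in N -> x = 1) -> C (quotg N) -> C G.
Proof.
move=> N1; apply: (@class_embedding _ _ (quotg_pi N)); apply: gmulf_inj => x.
by move=> /quotg_pi_eq1 /N1.
Qed.

Lemma gruenberg_extension : gruenberg C -> extension_closed C.
Proof.
move=> grC G N CN CGN.
(* The kernel of the identity serves as the trivial subgroup of [N]. *)
have [|T TZ] := grC G N (kerg (@idfun (subg N))) _ CGN.
  exact: class_quotient_ker.
apply: class_quotient1 => x /TZ[z /eqP z1 <-].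
by rewrite (_ : z = 1) ?val1.
Qed.

(** Closure under subgroups lets embeddings of the kernel and of the quotient replace
    isomorphisms. *)
Lemma extension_ker (G H K : groupType) (f : hom G H) (g : hom (subg (kerg f)) K) :
  extension_closed C -> injective g -> C K -> C H -> C G.
Proof.
move=> extC gI CK CH; apply: (extC G (kerg f)).
  exact: class_embedding gI CK.
exact: class_quotient_ker.
Qed.

Lemma extension_product : extension_closed C -> product_closed C.
Proof.
move=> extC G H CG CH.
pose f : hom (G * H)%type H := snd.
pose g : hom (subg (kerg f)) G := fst \o val.
apply: (extension_ker (g := g)) => //.
apply: gmulf_inj => w w1; apply: val_inj; rewrite val1.
have /eqP w2 : f (val w) == 1 := valP w.
by rewrite [LHS]surjective_pairing; congr (_, _).
Qed.

Lemma gruenberg_wreath : gruenberg C -> wreath_closed C.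
Proof.
move=> grC X Y CX CY.
have [||T TZ] := grC _ (kerg (@wr_top X Y)) (kerg (@wr_eval X Y)).
- exact: class_quotient_ker.
- exact: class_quotient_ker.
apply: class_quotient1 => w wT.
have [v _ vw] := TZ w wT.
have w1 : w.1 = 1 by rewrite -vw kerg_wr_topE.
rewrite [w]surjective_pairing w1; congr (_, _).
apply: functional_extensionality_dep => u.
(* conjugating w by u moves its coordinate at u to 1 *)
have [v' /eqP + v'w] := TZ _ (gpred_conj w ((u, 1) : wreath X Y) wT).
rewrite /= /wr_eval v'w conjgE [w]surjective_pairing w1 !wreathM /=.
by rewrite invg1 !wr_act_one mul1g mulg1 /wr_act mulg1.
Qed.

Lemma wreath_gruenberg : wreath_closed C -> gruenberg C.
Proof.
move=> wrC X Y Z CYZ CXY; pose T : normalClosed X := kerg (kk Z).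
exists T.
  by move=> t /eqP /kk_ker.
by apply: class_quotient_ker; apply: wrC.
Qed.

Lemma wreath_power : wreath_closed C -> cartesian_power_closed C.
Proof.
move=> wrC X Y CX CY X_ XX_.
(* Choice fixes an embedding into [X] for all [y] at once, which puts the product inside the base
   group. *)
have f y : {f : X_ y -> X | {morph f : a b / a * b} & injective f}.
  apply: cid2; have [f /bij_inj fI] := isomorphic_sym (XX_ y).
  by exists f => //; exact: gmulfM.
pose g (a : cprod X_) : wreath X Y := wr_base (fun y => s2val (f y) (a y)).
have gM : {morph g : a b / a * b}.
  move=> a b; rewrite /g -wr_base_morph; congr wr_base.
  by apply: functional_extensionality_dep => y; apply: (s2valP (f y)).
pose g' : hom (cprod X_) (wreath X Y) :=
  HB.pack g (isGroupMorphism.Build _ _ g (morphF gM)).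
apply: (@class_embedding _ _ g'); last exact: wrC.
move=> a b /wr_base_inj ab; apply: functional_extensionality_dep => y.
exact: s2valP' (f y) _ _ (congr1 (fun h : cprod (fun=> X) => h y) ab).
Qed.

Lemma extension_power_wreath :
  extension_closed C -> cartesian_power_closed C -> wreath_closed C.
Proof.
move=> extC powC X Y CX CY.
pose g (w : subg (kerg (@wr_top X Y))) : cprod (fun _ : Y => X) := (val w).2.
have gM : {morph g : v w / v * w}.
  by move=> v w; rewrite /g valM wreathM (kerg_wr_topE w) wr_act1.
pose g' : hom _ (cprod (fun _ : Y => X)) :=
  HB.pack g (isGroupMorphism.Build _ _ g (morphF gM)).
apply: (extension_ker (g := g')) => //.
  move=> v w /= vw; apply: val_inj; apply/pair_eqP.
  by apply/andP; split; apply/eqP; rewrite ?kerg_wr_topE.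
by apply: (powC X Y) => // y; exists idfun; exists idfun.
Qed.

End ClassClosure.

Theorem theorem1 (C : groupType -> Prop)
    (isoC : isomorphism_closed C) (subC : subgroup_closed C) :
  (gruenberg C -> root_class C) /\
  [<-> gruenberg C;
       wreath_closed C;
       extension_closed C /\ cartesian_power_closed C].
Proof.
have [wrG extP] := (wreath_gruenberg isoC subC, extension_product isoC subC).
have grE := gruenberg_extension isoC subC.
(* A direct product is an extension of one factor by the other. *)
split=> [grC|]; first by split=> //; apply/extP/grE.
tfae.
- exact: (gruenberg_wreath isoC subC).
(* Closure under extensions is reached through the Gruenberg condition. *)
- by move=> wrC; split; [apply/grE/wrG | apply: (wreath_power isoC subC)].
- by case=> extC powC; apply/wrG/(extension_power_wreath isoC subC).
Qed.
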